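(* Let $G$ be a finitely generated subgroup of $\mathrm{Aut}(\mathcal T_2)$ such that $G$ is self-similar, the action of $G$ on the boundary $\partial\mathcal T_2$ is essentially free, and the action of $G$ on $\mathcal T_2$ is spherically transitive. Then for every positive integer $p$, the group $\mathfrak T^{(p)}(G)$ distinguishes the classes $\mathscr C_{2^p}^2$ and $\mathscr C_{2^p-1}^2$; that is, $\mathfrak T^{(p)}(G)$ belongs to $\mathscr C_{2^p}^2$ but does not belong to $\mathscr C_{2^p-1}^2$.
   Context: $\mathcal T_2$ is the $2$-regular rooted tree: its vertex set $\mathcal T_2^0$ is the set of finite words over $\{1,2\}$, the root is the empty word, and each $w$ is joined to $w1,w2$. $L_n$ is the $n$-th level (words of length $n$). $\mathrm{Aut}(\mathcal T_2)$ is the group of rooted tree automorphisms. $\partial\mathcal T_2$ is the set of infinite geodesic paths starting at the root, and $\mu$ is the probability measure on it giving mass $2^{-n}$ to the set of paths through any given vertex of $L_n$. The action of $G$ on $\partial\mathcal T_2$ is essentially free if for every $g\in G\setminus\{1\}$ the fixed point set of $g$ in $\partial\mathcal T_2$ has $\mu$-measure $0$. It is spherically transitive on $\mathcal T_2$ if it is transitive on every $L_n$. For $g\in\mathrm{Aut}(\mathcal T_2)$ and a vertex $v$, $\varphi_{g(v)}(g)\in\mathrm{Aut}(\mathcal T_2)$ is defined by $g(vw)=g(v)\,\varphi_{g(v)}(g)(w)$ for all words $w$; $G$ is self-similar if $\varphi_v(g)\in G$ for all $g\in G$ and all vertices $v$. For $g\in\mathrm{Aut}(\mathcal T_2)$ let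 $(1,g)$ denote the automorphism fixing $L_1$, acting trivially on the subtree rooted at the vertex $1$ and acting as $g$ on the subtree rooted at the vertex $2$ (identified with $\mathcal T_2$). $\mathfrak T(G)$ is the subgroup of $\mathrm{Aut}(\mathcal T_2)$ generated by $G\cup\{(1,g)\mid g\in G\}$, and $\mathfrak T^{(p)}(G)$ is the group obtained from $G$ by applying $\mathfrak T$ $p$ times. For a subgroup $H$ of $\mathrm{Aut}(\mathcal T_2)$, $\rho$ is the unitary representation of $H$ on $\ell^2(\mathcal T_2^0)$ given by $(\rho(h)\xi)(x)=\xi(h^{-1}x)$, and $\rho^{\otimes q}$ is its $q$-th tensor power (coming from the diagonal action of $H$ on $(\mathcal T_2^0)^q$). For a positive integer $q$, $H$ belongs to the class $\mathscr C_q^2$ if the regular representation $\lambda$ of $H$ on $\ell^2(H)$ is weakly contained in $\rho^{\otimes q}$, i.e. $\|\lambda(x)\|\le\|\rho^{\otimes q}(x)\|$ for all $x\in\mathbb C H$. *)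

(* Defs.v *)
From HB Require Import structures.
From mathcomp Require Import all_boot all_order all_algebra.
From mathcomp Require Import all_classical all_reals all_analysis.
From mathcomp Require Import complex.

Set Implicit Arguments.
Unset Strict Implicit.
Unset Printing Implicit Defensive.

Import Order.TTheory GRing.Theory Num.Theory.
Import numFieldNormedType.Exports.

Local Open Scope classical_set_scope.
Local Open Scope ring_scope.

(* The letters 1 and 2 of the text are [false] and [true]. *)
Notation vertex := (seq bool).

Definition adjacent (u v : vertex) : Prop :=
  exists b : bool, v = rcons u b \/ u = rcons v b.

Record T2aut := MkT2aut {
  aut_fun :> vertex -> vertex;
  aut_inv : vertex -> vertex;
  aut_funK : cancel aut_fun aut_inv;
  aut_invK : cancel aut_inv aut_fun;
  aut_root : aut_fun [::] = [::];
  aut_adj : forall u v, adjacent (aut_fun u) (aut_fun v) <-> adjacent u v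
}.

Lemma T2autP (g h : T2aut) : aut_fun g =1 aut_fun h -> g = h.
Proof.
case: g h => [f f' fK f'K fr fa] [k k' kK k'K kr ka] /= /funext fk.
subst k; have e : f' = k'.
  by apply/funext => v; rewrite -{1}[v]k'K fK.
by subst k'; congr MkT2aut; exact: Prop_irrelevance.
Qed.

HB.instance Definition _ := gen_eqMixin T2aut.
HB.instance Definition _ := gen_choiceMixin T2aut.

Definition aut_one : T2aut :=
  @MkT2aut id id (fun=> erefl) (fun=> erefl) erefl (fun u v => iff_refl _).

Fact aut_mul_adj (g h : T2aut) u v :
  adjacent ((g \o h) u) ((g \o h) v) <-> adjacent u v.
Proof. by rewrite /= !aut_adj. Qed.

Fact aut_mul_root (g h : T2aut) : (g \o h) [::] = [::].
Proof. by rewrite /= !aut_root. Qed.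

(* Automorphisms act on the left, so that [(g * h) v = g (h v)]. *)
Definition aut_mul (g h : T2aut) : T2aut :=
  MkT2aut (can_comp (aut_funK g) (aut_funK h))
          (can_comp (aut_invK h) (aut_invK g))
          (aut_mul_root g h) (aut_mul_adj g h).

Fact aut_inv_root (g : T2aut) : aut_inv g [::] = [::].
Proof. by rewrite -{1}(aut_root g) aut_funK. Qed.

Fact aut_inv_adj (g : T2aut) u v :
  adjacent (aut_inv g u) (aut_inv g v) <-> adjacent u v.
Proof. by rewrite -(aut_adj g) !aut_invK. Qed.

Definition aut_opp (g : T2aut) : T2aut :=
  MkT2aut (aut_invK g) (aut_funK g) (aut_inv_root g) (@aut_inv_adj g).

Fact aut_mulA : associative aut_mul.
Proof. by move=> g h k; exact: T2autP. Qed.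
Fact aut_mul1g : left_id aut_one aut_mul.
Proof. by move=> g; exact: T2autP. Qed.
Fact aut_mulg1 : right_id aut_one aut_mul.
Proof. by move=> g; exact: T2autP. Qed.
Fact aut_mulVg : left_inverse aut_one aut_opp aut_mul.
Proof. by move=> g; apply: T2autP => v /=; rewrite aut_funK. Qed.
Fact aut_mulgV : right_inverse aut_one aut_opp aut_mul.
Proof. by move=> g; apply: T2autP => v /=; rewrite aut_invK. Qed.

HB.instance Definition _ := isGroup.Build T2aut
  aut_mulA aut_mul1g aut_mulg1 aut_mulVg aut_mulgV.

Lemma aut_size (g : T2aut) (v : vertex) : size (g v) = size v.
Proof.
suff: size (g v) = size v /\ forall b, exists c, g (rcons v b) = rcons (g v) c.
  by case.
elim/last_ind: v => [|v b [IHs IHc]].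
  rewrite aut_root; split=> // b.
  have /(aut_adj g) : adjacent [::] (rcons [::] b) by exists b; left.
  rewrite aut_root => -[c [->|/(congr1 size)]]; first by exists c.
  by rewrite size_rcons.
have [c gvb] := IHc b; split; first by rewrite gvb !size_rcons IHs.
move=> b'.
have /(aut_adj g) : adjacent (rcons v b) (rcons (rcons v b) b').
  by exists b'; left.
case=> d [->|]; first by exists d.
rewrite gvb => /rcons_inj[/(can_inj (aut_funK g)) /(congr1 size) + _].
by rewrite !size_rcons => /eqP; rewrite -[X in X == _]addn0 -addn2 eqn_add2l.
Qed.

Lemma aut_rcons (g : T2aut) (v : vertex) b :
  exists c, g (rcons v b) = rcons (g v) c.
Proof.
have /(aut_adj g) : adjacent v (rcons v b) by exists b; left.
case=> d [->|/(congr1 size)]; first by exists d.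
rewrite size_rcons !aut_size size_rcons => /eqP.
by rewrite -[X in X == _]addn0 -addn2 eqn_add2l.
Qed.

Lemma aut_cat (g : T2aut) (v w : vertex) :
  g (v ++ w) = g v ++ drop (size v) (g (v ++ w)).
Proof.
suff [t ->] : exists t, g (v ++ w) = g v ++ t.
  by rewrite -(aut_size g v) drop_size_cat.
elim/last_ind: w => [|w b [t IH]]; first by exists [::]; rewrite !cats0.
have [c] := aut_rcons g (v ++ w) b.
by rewrite -rcons_cat => ->; rewrite IH rcons_cat; exists (rcons t c).
Qed.

Lemma adjacent_catl (u v w : vertex) :
  adjacent (u ++ v) (u ++ w) <-> adjacent v w.
Proof.
have catI : injective (cat u) by move=> s t /(congr1 (drop (size u))); rewrite !drop_size_cat.
split=> -[b [|] e]; exists b.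
- by left; apply: catI; rewrite -rcons_cat.
- by right; apply: catI; rewrite -rcons_cat.
- by left; rewrite e rcons_cat.
- by right; rewrite e rcons_cat.
Qed.

(* [section v g] is the automorphism with g (v w) = g(v) (section v g) (w). *)
Definition section_fun (v : vertex) (g : T2aut) (w : vertex) : vertex :=
  drop (size v) (g (v ++ w)).

Fact section_funK v (g : T2aut) :
  cancel (section_fun v g) (section_fun (g v) (g^-1)%g).
Proof.
by move=> w; rewrite /section_fun -aut_cat /= aut_funK aut_size drop_size_cat.
Qed.

Fact section_invK v (g : T2aut) :
  cancel (section_fun (g v) (g^-1)%g) (section_fun v g).
Proof.
by move=> w; have := @section_funK (g v) (g^-1)%g w; rewrite /= aut_funK invgK.
Qed.

Fact section_root v (g : T2aut) : section_fun v g [::] = [::].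
Proof. by rewrite /section_fun cats0 -(aut_size g v) drop_size. Qed.

Fact section_adj v (g : T2aut) u w :
  adjacent (section_fun v g u) (section_fun v g w) <-> adjacent u w.
Proof. by rewrite -(adjacent_catl (g v)) -!aut_cat aut_adj adjacent_catl. Qed.

Definition section (v : vertex) (g : T2aut) : T2aut :=
  MkT2aut (@section_funK v g) (@section_invK v g) (section_root v g)
          (@section_adj v g).

Definition phi (u : vertex) (g : T2aut) : T2aut := section ((g^-1)%g u) g.

Lemma phiP (g : T2aut) (v w : vertex) : g (v ++ w) = g v ++ phi (g v) g w.
Proof. by rewrite /phi /= aut_funK -aut_cat. Qed.

(* A geodesic ray from the root is encoded by the sequence of its letters; its
   vertex of level [n] is [mkseq w n]. *)
Definition cylinder (v : vertex) : set (nat -> bool) :=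
  [set w | mkseq w (size v) = v].

Notation boundary := (g_sigma_algebraType (range cylinder)).

Definition boundary_act (g : T2aut) (w : boundary) : boundary :=
  fun n => nth false (g (mkseq w n.+1)) n.

Lemma boundary_actE (g : T2aut) (w : boundary) n :
  mkseq (boundary_act g w) n = g (mkseq w n).
Proof.
elim: n => [|n IHn]; first by rewrite /= aut_root.
rewrite mkseqS IHn /boundary_act mkseqS.
have [c ->] := aut_rcons g (mkseq w n) (w n).
by rewrite nth_rcons aut_size size_mkseq ltnn eqxx.
Qed.

(* The measure is the image of the Lebesgue measure of [0, 1[ under binary
   expansion; [boundary_measure_cylinder] below is its defining property. *)
Section boundary_measure.
Variable R : realType.
Let D : set R := `[0, 1[.
Definition digits (x : R) : boundary :=
  fun n => odd (Num.truncn (2 ^+ n.+1 * x)).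
Definition ray (x : R) : boundary := if 0 <= x < 1 then digits x else (fun=> false).
Let value (v : vertex) : nat := foldl (fun k (b : bool) => b + k.*2)%N 0%N v.

Let value_rcons v b : value (rcons v b) = (b + (value v).*2)%N.
Proof. by rewrite /value foldl_rcons. Qed.

Let mkseq_digits x n v : 0 <= x < 1 -> size v = n ->
  mkseq (digits x) n = v <-> Num.truncn (2 ^+ n * x) = value v.
Proof.
move=> /andP[x0 x1]; elim: n v => [|n IHn] v.
  move/size0nil ->; split=> // _.
  by rewrite expr0 mul1r /value/=; apply/eqP; rewrite truncn_eq// x0.
elim/last_ind: v => // v b _; rewrite size_rcons => -[sv].
rewrite mkseqS value_rcons.
have y0 : 0 <= 2 ^+ n * x by rewrite mulr_ge0// exprn_ge0.
set y := 2 ^+ n * x in IHn y0 *.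
have half : Num.truncn (2 ^+ n.+1 * x) =
    (odd (Num.truncn (2 ^+ n.+1 * x)) + (Num.truncn y).*2)%N.
  rewrite exprS -mulrA -/y -[LHS]odd_double_half; congr (_ + _.*2)%N.
  have z0 : 0 <= 2 * y by rewrite mulr_ge0.
  apply/esym/eqP; rewrite truncn_eq//.
  have /andP[] := truncn_itv z0; set m := Num.truncn _ => m1 m2.
  have em := odd_double_half m.
  have m3 : (m./2.*2)%:R <= 2 * y.
    by apply: le_trans m1; rewrite ler_nat -[leqRHS]em leq_addl.
  have m4 : 2 * y < (m./2.+1.*2)%:R.
    apply: lt_le_trans m2 _; rewrite ler_nat -{1}em doubleS ltnS.
    by rewrite -add1n leq_add2r leq_b1.
  move: m3 m4; rewrite -!mul2n !natrM ler_pM2l// ltr_pM2l//.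
  by move=> -> ->.
have -> : digits x n = odd (Num.truncn (2 ^+ n.+1 * x)) by [].
split.
- by case/rcons_inj => /(IHn _ sv) e <-; rewrite {1}half e.
- move=> e; have ob : odd (Num.truncn (2 ^+ n.+1 * x)) = b.
    by rewrite e oddD odd_double addbF oddb.
  rewrite ob; congr rcons; apply/(IHn _ sv).
  by move: half; rewrite ob e => /addnI /double_inj ->.
Qed.

Let itv_value (v : vertex) : interval R :=
  `[(value v)%:R / 2 ^+ size v, (value v).+1%:R / 2 ^+ size v[.

Let value_lt v : (value v < 2 ^ size v)%N.
Proof.
elim/last_ind: v => // v b; rewrite value_rcons size_rcons expnS mul2n.
by rewrite -leq_double; apply: leq_trans; rewrite doubleS ltnS -add1n leq_add2r leq_b1.
Qed.

Let ray_cylinder v : D `&` ray @^-1` cylinder v = [set` itv_value v].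
Proof.
have p0 : 0 < 2 ^+ size v :> R by rewrite exprn_gt0.
have xP x : 0 <= x < 1 -> (x \in itv_value v) = (Num.truncn (2 ^+ size v * x) == value v).
  move=> /andP[x0 x1]; rewrite truncn_eq ?mulr_ge0 ?(ltW p0)//.
  by rewrite in_itv/= ler_pdivrMr// ltr_pdivlMr// mulrC.
apply/seteqP; split=> x /=.
  rewrite /D/= in_itv/= => -[xD].
  rewrite /cylinder/= /ray xD.
  by move/(mkseq_digits xD erefl)/eqP; rewrite xP.
move=> xv; have xD : 0 <= x < 1.
  move: xv; rewrite in_itv/= => /andP[lx xu]; apply/andP; split.
    by apply: le_trans lx; rewrite divr_ge0// ltW.
  apply: lt_le_trans xu _; rewrite ler_pdivrMr// mul1r -natrX ler_nat.
  exact: value_lt.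
split; first by rewrite /D/= in_itv.
rewrite /cylinder/= /ray xD.
by apply/(mkseq_digits xD erefl)/eqP; rewrite -xP.
Qed.

Let measurable_ray : measurable_fun [set: R] ray.
Proof.
apply: (@measurability _ _ _ _ setT ray (range cylinder)) => //.
move=> _ [_ [v _ <-] <-]; rewrite setTI.
have mD : measurable D by exact: measurable_itv.
rewrite -[X in measurable X](setUIDK _ D) setIC ray_cylinder.
apply: measurableU; first exact: measurable_itv.
have [v0|v0] := pselect (cylinder v (fun=> false)).
- rewrite [X in measurable X](_ : _ = ~` D); first exact: measurableC.
  apply/seteqP; split=> x /= => [[]//|xD]; split=> //.
  by rewrite /ray; move: xD; rewrite /D/= in_itv/= => /negP/negPf ->.
- rewrite [X in measurable X](_ : _ = set0)//.
  apply/seteqP; split=> x //= -[] + xD.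
  by rewrite /ray; move: xD; rewrite /D/= in_itv/= => /negP/negPf ->.
Qed.

HB.instance Definition _ := isMeasurableFun.Build _ _ _ _ ray measurable_ray.

Definition boundary_measure : set boundary -> \bar R :=
  pushforward (mrestr lebesgue_measure (measurable_itv `[(0 : R), 1[)) ray.

Fact boundary_measure0 : boundary_measure set0 = 0%E.
Proof. exact: measure0. Qed.

Fact boundary_measure_ge0 A : (0 <= boundary_measure A)%E.
Proof. exact: measure_ge0. Qed.

Fact boundary_measure_sigma_additive : semi_sigma_additive boundary_measure.
Proof. exact: measure_semi_sigma_additive. Qed.

HB.instance Definition _ := isMeasure.Build _ _ _ boundary_measure
  boundary_measure0 boundary_measure_ge0 boundary_measure_sigma_additive.

Lemma boundary_measure_cylinder v :
  boundary_measure (cylinder v) = (2^-1 ^+ size v)%:E.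
Proof.
rewrite /boundary_measure /pushforward /mrestr setIC ray_cylinder.
rewrite lebesgue_measure_itv/=.
rewrite lte_fin ltr_pM2r ?invr_gt0 ?exprn_gt0// ltr_nat ltnSn.
by rewrite -EFinB -mulrBl -natrB// subSnn mul1r exprVn.
Qed.

Fact boundary_measure_setT : boundary_measure setT = 1%E.
Proof.
rewrite (_ : setT = cylinder [::]) ?boundary_measure_cylinder ?expr0//.
by apply/seteqP; split.
Qed.

HB.instance Definition _ := @Measure_isProbability.Build _ _ _
  boundary_measure boundary_measure_setT.

End boundary_measure.

Definition is_subgroup (H : set T2aut) : Prop :=
  [/\ H 1%g, forall g h, H g -> H h -> H (g * h)%g & forall g, H g -> H (g^-1)%g].

Definition generated (A : set T2aut) : set T2aut := smallest is_subgroup A.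

Definition finitely_generated (H : set T2aut) : Prop :=
  exists2 A : set T2aut, finite_set A & H = generated A.

Definition self_similar (G : set T2aut) : Prop :=
  forall (g : T2aut) (v : vertex), G g -> G (phi v g).

Definition spherically_transitive (G : set T2aut) : Prop :=
  forall (n : nat) (u v : vertex), size u = n -> size v = n ->
    exists2 g, G g & g u = v.

Definition essentially_free (R : realType) (G : set T2aut) : Prop :=
  forall g, G g -> g <> 1%g ->
    boundary_measure R [set w | boundary_act g w = w] = 0%E.

Definition pair1_fun (f : vertex -> vertex) (v : vertex) : vertex :=
  if v is true :: w then true :: f w else v.

Fact pair1_funK (f f' : vertex -> vertex) :
  cancel f f' -> cancel (pair1_fun f) (pair1_fun f').
Proof. by move=> fK [|[] w] //=; rewrite fK. Qed.

Fact pair1_root (f : vertex -> vertex) : pair1_fun f [::] = [::].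
Proof. by []. Qed.

Fact pair1_adj (g : T2aut) u v :
  adjacent (pair1_fun g u) (pair1_fun g v) <-> adjacent u v.
Proof.
have imp (h : T2aut) s t : adjacent s t -> adjacent (pair1_fun h s) (pair1_fun h t).
  have main s' b : adjacent (pair1_fun h s') (pair1_fun h (rcons s' b)).
    case: s' => [|[] w] /=.
    - by case: b; rewrite ?aut_root; [exists true; left|exists false; left].
    - by have [c ->] := aut_rcons h w b; exists c; left.
    - by exists b; left.
  case=> b [->|->]; first exact: main.
  by have [c [e|e]] := main t b; exists c; [right|left].
split; last exact: imp.
have gK := pair1_funK (aut_funK g).
by move/(imp (g^-1)%g); rewrite /= !gK.
Qed.

(* The automorphism (1, g) of the text; the letter 2 is [true]. *)
Definition pair1 (g : T2aut) : T2aut :=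
  MkT2aut (pair1_funK (aut_funK g)) (pair1_funK (aut_invK g))
          (pair1_root g) (@pair1_adj g).

Definition frakT (G : set T2aut) : set T2aut :=
  generated (G `|` [set pair1 g | g in G]).

Definition iter_frakT (p : nat) (G : set T2aut) : set T2aut := iter p frakT G.

Section representations.
Variable R : realType.
Local Notation C := R[i].

Definition group_algebra (H : set T2aut) : set (T2aut -> C) :=
  [set x | finite_set [set h | x h != 0] /\ [set h | x h != 0] `<=` H].

(* l^2(D), for D a subset of X, consists of the functions [xi : X -> C] for
   which this norm is finite, considered up to their values outside D. *)
Definition l2_norm (X : choiceType) (D : set X) (xi : X -> C) : \bar R :=
  sqrte (\esum_(y in D) (complex.Re (xi y) ^+ 2 + complex.Im (xi y) ^+ 2)%:E).

(* The action of an element of the group algebra on functions on X by the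
   linear extension of (h xi)(y) = xi (h^-1 y). *)
Definition perm_rep (X : choiceType) (act : T2aut -> X -> X)
    (x : T2aut -> C) (xi : X -> C) : X -> C :=
  fun y => \sum_(h \in [set: T2aut]) x h * xi (act (h^-1)%g y).

(* Operator norm of x on l^2(D); only meaningful when D is stable under a
   group containing the support of x. *)
Definition perm_rep_norm (X : choiceType) (D : set X)
    (act : T2aut -> X -> X) (x : T2aut -> C) : \bar R :=
  ereal_sup [set l2_norm D (perm_rep act x xi) |
             xi in [set xi : X -> C | (l2_norm D xi <= 1)%E]].

Definition regular_norm (H : set T2aut) (x : T2aut -> C) : \bar R :=
  perm_rep_norm H (fun g h : T2aut => (g * h)%g) x.

Definition diag_act (q : nat) (g : T2aut) (t : q.-tuple vertex) :
  q.-tuple vertex := map_tuple g t.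

(* The q-th tensor power of l^2(X) is identified with l^2(X^q). *)
Definition tensor_norm (q : nat) (x : T2aut -> C) : \bar R :=
  perm_rep_norm [set: q.-tuple vertex] (@diag_act q) x.

Definition class_C (q : nat) (H : set T2aut) : Prop :=
  forall x, group_algebra H x -> (regular_norm H x <= tensor_norm q x)%E.

End representations.

(* Main.v *)
(* If for every finite set F of nontrivial elements of H some q-tuple of vertices
   is fixed by no element of F, then finitely many values of a function on H can
   be transported along an orbit map that is injective where it matters, so the
   regular representation is weakly contained in rho^(tensor q). For G itself a
   single vertex suffices: almost every boundary point is moved by all of F. If
   t works for the sections of F at the first level, then the concatenation of
   1t and 2t works for F, so each application of T doubles the length.
   Conversely T^(p)(G) contains, for each of the 2^p vertices v of level p, a
   nontrivial element g_v supported below v. The product of the 1 - g_v is a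
   nonzero element of the group algebra, but it vanishes on tuples of fewer than
   2^p vertices: some v has no entry of the tuple below it, so g_v fixes the
   tuple. *)
Require Import Defs.
From mathcomp Require Import all_boot all_order all_algebra.
From mathcomp Require Import all_classical all_reals all_analysis.
From mathcomp Require Import complex.

Set Implicit Arguments.
Unset Strict Implicit.
Unset Printing Implicit Defensive.

Import Order.TTheory GRing.Theory Num.Theory.

Local Open Scope classical_set_scope.
Local Open Scope ring_scope.

(** * Separating actions and weak containment of the regular representation *)

Definition separating (X : Type) (act : T2aut -> X -> X) (H : set T2aut) :=
  forall F : seq T2aut, (forall g, g \in F -> H g /\ g <> 1%g) ->
    exists t, forall g, g \in F -> act g t <> t.

Section norms.
Variable R : realType.
Local Notation C := R[i].
Local Notation sqmod z := ((complex.Re z ^+ 2 + complex.Im z ^+ 2)%:E).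

Lemma esum_le_subset (Y : choiceType) (A B : set Y) (a : Y -> \bar R) :
  A `<=` B -> (\esum_(i in A) a i <= \esum_(i in B) a i)%E.
Proof.
move=> AB; apply: ereal_sup_le => _ [F [finF FA] <-].
by exists F => //; split=> // y /FA /AB.
Qed.

Lemma sqmod_ge0 (z : C) : (0 <= sqmod z)%E.
Proof. by rewrite lee_fin addr_ge0// sqr_ge0. Qed.

Lemma sqmod0 : sqmod (0 : C) = 0%E.
Proof. by rewrite !expr0n addr0. Qed.

Lemma l2_norm_sqr (X : choiceType) (D : set X) (xi : X -> C) :
  (l2_norm D xi ^+ 2 = \esum_(y in D) sqmod (xi y))%E.
Proof. by rewrite /l2_norm sqr_sqrte// esum_ge0// => y _; apply: sqmod_ge0. Qed.

Lemma l2_norm0 (X : choiceType) (D : set X) (xi : X -> C) :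
  (forall y, xi y = 0) -> l2_norm D xi = 0%E.
Proof.
by move=> xi0; rewrite /l2_norm esum1 ?sqrte0// => y _; rewrite xi0 sqmod0.
Qed.

Lemma perm_rep_seq (X : choiceType) (act : T2aut -> X -> X) (s : seq T2aut)
    (x : T2aut -> C) (xi : X -> C) (y : X) :
  uniq s -> (forall h, x h != 0 -> h \in s) ->
  perm_rep act x xi y = \sum_(h <- s) x h * xi (act (h^-1)%g y).
Proof.
move=> us xs; rewrite /perm_rep (@fsbigE _ _ _ _ _ s _ us)//.
  by apply: eq_bigl => h; rewrite in_setT.
move=> h _ /negP hs; have [->|/xs//] := eqVneq (x h) 0; exact: mul0r.
Qed.

(* If the orbit map of a point t is injective on a finite set S, then the
   restriction of xi to S is transported to the orbit of t without changing its
   norm, and x acts in the same way on both functions at every point b with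
   supp(x)^-1 b contained in S. *)
Lemma regular_norm_le (X : choiceType) (act : T2aut -> X -> X)
    (H : set T2aut) (x : T2aut -> C) :
  (forall u, act 1%g u = u) ->
  (forall g h u, act (g * h)%g u = act g (act h u)) ->
  is_subgroup H -> separating act H -> group_algebra H x ->
  (regular_norm H x <= perm_rep_norm setT act x)%E.
Proof.
move=> act1 actM [H1 HM HV] sepH [/finite_seqP[sx sxE] xH].
set c := perm_rep_norm _ _ _; apply: ge_ereal_sup => _ [xi xi1 <-].
have cP eta : (l2_norm setT eta <= 1)%E ->
    (l2_norm setT (perm_rep act x eta) <= c)%E.
  by move=> eta1; apply: ereal_sup_ubound; exists eta.
have c_ge0 : (0 <= c)%E.
  by apply: le_trans (cP (fun=> 0) _); rewrite ?sqrte_ge0// l2_norm0.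
(* Squaring replaces the norm on the left by a supremum of finite sums, so it suffices to bound the
   sum over each finite subset [sB] of [H] by the square of [c]. *)
rewrite -[c]gee0_abs// -sqrte_sqr lee_sqrt ?sqre_ge0//.
apply: ge_ereal_sup => _ [B [/finite_seqP[sB ->] BH] <-].
have xs h : x h != 0 -> h \in undup sx.
  by rewrite mem_undup => xh; have : [set` sx] h by rewrite -sxE.
have sxH h : h \in sx -> H h.
  by move=> hs; apply: xH; rewrite sxE.
(* On [sB], the function obtained by applying [x] to [xi] depends only on the values of [xi] on
   [S]. *)
pose S := undup (sB ++ [seq (h^-1 * b)%g | h <- sx, b <- sB]).
have SH h : h \in S -> H h.
  rewrite mem_undup mem_cat => /orP[/BH//|/allpairsP[[k b] /= [ks bB ->]]].
  by apply: HM; [apply/HV/sxH|exact: BH].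
(* A point moved by every nontrivial quotient of two elements of [S] has an orbit map injective on
   [S]. *)
pose F := [seq f <- [seq (h^-1 * k)%g | h <- S, k <- S] | f != 1%g].
have [|t tF] := sepH F.
  move=> f; rewrite mem_filter => /andP[/eqP f1].
  move=> /allpairsP[[h k] /= [hS kS fE]]; split=> //.
  by rewrite fE; apply: HM; [apply/HV|]; exact: SH.
have injS h k : h \in S -> k \in S -> act h t = act k t -> h = k.
  move=> hS kS hk; apply/eqP/negPn/negP => neq.
  apply: (tF (h^-1 * k)%g); last by rewrite actM -hk -actM mulVg act1.
  rewrite mem_filter; apply/andP; split; last first.
    exact: (allpairs_f (fun h k => (h^-1 * k)%g)).
  by apply: contra neq => /eqP e; rewrite -[k](mulVKg h) e mulg1.
(* By [injS] at most one summand can be nonzero. *)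
pose eta u := \sum_(k <- S) if act k t == u then xi k else 0.
have etaE h : h \in S -> eta (act h t) = xi h.
  move=> hS; rewrite /eta (bigD1_seq h) ?undup_uniq//= eqxx big1_seq ?addr0//.
  move=> k /andP[kh kS]; case: eqP => // /(injS _ _ kS hS) e.
  by rewrite e eqxx in kh.
have eta0 u : ~ [set act h t | h in [set` S]] u -> eta u = 0.
  move=> Su; apply: big1_seq => k /= kS; case: eqP => // e.
  by case: Su; exists k.
have eta1 : (l2_norm setT eta <= 1)%E.
  apply: le_trans xi1; rewrite /l2_norm lee_sqrt; last first.
    by apply: esum_ge0 => ? _; exact: sqmod_ge0.
  apply: (@le_trans _ _
      (\esum_(u in [set act h t | h in [set` S]]) sqmod (eta u))%E).
    rewrite [leRHS]esum_mkcond; apply: le_esum => u _; case: ifPn => //.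
    by rewrite notin_setE => /eta0 ->; rewrite sqmod0.
  rewrite esum_image; last by move=> h k /[!inE]; exact: injS.
  rewrite (eq_esum (b := fun h => sqmod (xi h))).
    by apply: esum_le_subset => h; exact: SH.
  by move=> h /etaE ->.
have BS : {subset sB <= S} by move=> b bB; rewrite mem_undup mem_cat bB.
have repE b : b \in sB ->
    perm_rep act x eta (act b t) = perm_rep (fun g h => (g * h)%g) x xi b.
  move=> bB; rewrite !(perm_rep_seq _ _ _ (undup_uniq sx) xs).
  apply: eq_big_seq => h; rewrite mem_undup => hx; congr (_ * _).
  rewrite -actM etaE// mem_undup mem_cat; apply/orP; right.
  exact: (allpairs_f (fun h b => (h^-1 * b)%g)).
(* The points [act b t] with [b] in [sB] are distinct, and by [repE] they alone contribute the
   required sum to the squared norm of the image of [eta]. *)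
apply: (@le_trans _ _ (l2_norm setT (perm_rep act x eta) ^+ 2)%E); last first.
  by rewrite lee_sqr ?sqrte_ge0// cP.
rewrite l2_norm_sqr -esum_fset//; last by move=> b _; exact: sqmod_ge0.
rewrite -(eq_esum (a := fun b => sqmod (perm_rep act x eta (act b t))));
  last first.
  by move=> b /repE ->.
rewrite -(esum_image [set` sB] (fun b => act b t)
  (fun u => sqmod (perm_rep act x eta u))); first exact: esum_le_subset.
by move=> h k /[!inE] /BS hS /BS; exact: injS.
Qed.
End norms.

(** * Essentially free boundary actions separate by a single vertex *)

Section boundary.
Variable R : realType.

Lemma boundary_act_fix (g : T2aut) (w : boundary) :
  boundary_act g w = w <-> forall n, g (mkseq w n) = mkseq w n.
Proof.
split=> [gw n|gw]; first by rewrite -boundary_actE gw.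
apply/funext => n; have := boundary_actE g w n.+1.
by rewrite gw !mkseqS => /rcons_inj[].
Qed.

(** The complement is the union of the cylinders over the vertices moved by [g], and there are
    countably many vertices. *)
Lemma measurable_boundary_fix (g : T2aut) :
  measurable [set w : boundary | boundary_act g w = w].
Proof.
pose U (v : vertex) : set boundary := if g v == v then set0 else cylinder v.
have -> : [set w : boundary | boundary_act g w = w] = ~` \bigcup_v U v.
  apply/seteqP; split=> w /=.
    move=> /boundary_act_fix gw [v _]; rewrite /U; case: eqP => // gv wv.
    by apply: gv; rewrite -[v]wv gw.
  move=> Uw; apply/boundary_act_fix => n; apply: contrapT => /eqP gw.
  apply: Uw; exists (mkseq w n) => //; rewrite /U (negPf gw).
  by rewrite /cylinder/= size_mkseq.
apply/measurableC/countable_bigcupT_measurable => // v.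
rewrite /U; case: ifP => // _.
by apply: sub_sigma_algebra; exists v.
Qed.

Lemma separating_boundary (G : set T2aut) :
  essentially_free R G -> separating (@diag_act 1) G.
Proof.
move=> freeG F FG.
(* The rays fixed by some element of [F] form a finite union of null sets, which cannot be the whole
   boundary of mass 1. *)
have : (boundary_measure R).-negligible
    [set w : boundary | exists2 g, g \in F & boundary_act g w = w].
  elim: F FG => [_|g F IHF FG].
    by apply: (negligibleS (A := set0)) => [w [g]//|]; exact: negligible_set0.
  have [|Gg g1] := FG g; first exact: mem_head.
  apply: (negligibleS (A := [set w : boundary | boundary_act g w = w] `|`
    [set w : boundary | exists2 g, g \in F & boundary_act g w = w])).
    by move=> w [h]; rewrite inE => /predU1P[->|hF] hw; [left|right; exists h].
  apply: negligibleU; last by apply: IHF => h hF; apply: FG; rewrite inE hF orbT.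
  by apply/negligibleP; [exact: measurable_boundary_fix|exact: freeG].
move=> negF; have [w /= wF] :
    exists w, ~ [set w : boundary | exists2 g, g \in F & boundary_act g w = w] w.
  apply: contrapT => /forallNP allF; move: negF.
  rewrite (_ : [set _ | _] = setT); last first.
    by apply/seteqP; split=> // w _; apply: contrapT; exact: allF.
  move=> /(negligibleP _ (@measurableT _ _)).
  by apply/eqP; rewrite [X in X == _](boundary_measure_setT R) onee_eq0.
(* The vertex sought is a long enough prefix of the ray [w]. *)
suff [n nF] : exists n, forall g, g \in F -> g (mkseq w n) <> mkseq w n.
  exists [tuple mkseq w n] => g gF /(congr1 val)[]; exact: nF.
elim: F wF {FG negF} => [_|g F IHF wF]; first by exists 0%N.
have [|n nF] := IHF.
  by case=> h hF hw; apply: wF; exists h; rewrite // inE hF orbT.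
have [m gm] : exists m, g (mkseq w m) <> mkseq w m.
  apply: contrapT => /forallNP gw; apply: wF; exists g; first exact: mem_head.
  by apply/boundary_act_fix => m; apply: contrapT; exact: gw.
(* Fixing a vertex fixes its ancestors, so a moved prefix stays moved when lengthened, and the
   larger of two levels serves for both. *)
have fix_le (h : T2aut) k l : (k <= l)%N -> h (mkseq w l) = mkseq w l ->
    h (mkseq w k) = mkseq w k.
  move=> kl; rewrite -(subnKC kl) /mkseq iotaD map_cat aut_cat.
  move=> /(congr1 (take k)); rewrite !take_size_cat//.
    by rewrite size_map size_iota.
  by rewrite aut_size size_map size_iota.
exists (maxn n m) => h; rewrite inE => /predU1P[->|/nF hn].
  by move=> /(fix_le _ _ _ (leq_maxr _ _)).
by move=> /(fix_le _ _ _ (leq_maxl _ _)).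
Qed.
End boundary.

(** * Sections, and inheritance of separation under [frakT] *)

Lemma generated_subgroup (A : set T2aut) : is_subgroup (generated A).
Proof.
split=> [|g h Ag Ah|g Ag] M AM; have [[M1 MM MV] _] := AM => //.
- by apply: MM; [exact: Ag|exact: Ah].
- by apply: MV; exact: Ag.
Qed.

Lemma sub_generated (A : set T2aut) : A `<=` generated A.
Proof. exact: sub_gen_smallest. Qed.

(** Self-similarity indexed by the source vertex [v] instead of its image [g v]; this form suits the
    composition rules for sections. *)
Definition section_closed (K : set T2aut) := forall v g, K g -> K (section v g).

Lemma self_similar_section (G : set T2aut) :
  self_similar G -> section_closed G.
Proof.
by move=> ssG v g /(ssG _ (g v)); rewrite /phi /= aut_funK.
Qed.

Lemma section_mul v (g h : T2aut) :
  section v (g * h)%g = (section (h v) g * section v h)%g.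
Proof.
by apply: T2autP => w; rewrite /= /section_fun /= -aut_cat aut_size.
Qed.

Lemma section_cat v w (g : T2aut) : section (v ++ w) g = section w (section v g).
Proof.
apply: T2autP => u /=; rewrite /section_fun /= /section_fun.
by rewrite catA size_cat drop_drop addnC.
Qed.

Lemma section_nil (g : T2aut) : section [::] g = g.
Proof. by apply: T2autP => u /=; rewrite /section_fun drop0. Qed.

Lemma section1 v : section v 1%g = 1%g.
Proof. by apply: T2autP => u /=; rewrite /section_fun /= drop_size_cat. Qed.

Lemma section_inv v (g : T2aut) :
  section v (g^-1)%g = ((section ((g^-1)%g v) g)^-1)%g.
Proof.
apply: (mulgI (section ((g^-1)%g v) g)).
by rewrite mulgV -section_mul mulgV section1.
Qed.

Lemma section_pair1 b (g : T2aut) :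
  section [:: b] (pair1 g) = if b then g else 1%g.
Proof. by apply: T2autP => w; case: b; rewrite /= /section_fun /= ?drop0. Qed.

(** The elements with all first-level sections in [K] form a subgroup containing both kinds of
    generators. Both vertices of level one are treated together because the section of a product at
    [v] involves a section at [h v]. *)
Lemma frakT_section (K : set T2aut) (b : bool) (g : T2aut) :
  is_subgroup K -> section_closed K -> frakT K g -> K (section [:: b] g).
Proof.
move=> [K1 KM KV] secK Kg.
pose S := [set h | forall v, size v = 1%N -> K (section v h)].
suff : S g by apply.
apply: Kg; split.
  split=> [v _|h k Sh Sk v v1|h Sh v v1]; first by rewrite section1.
  - by rewrite section_mul; apply: KM; [apply: Sh; rewrite aut_size|exact: Sk].
  - by rewrite section_inv; apply: KV; apply: Sh; rewrite aut_size.
move=> h [Kh v _|[k Kk <-] [//|c [|//]] _]; first exact: secK.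
by rewrite section_pair1; case: c.
Qed.

Lemma sub_frakT (K : set T2aut) : K `<=` frakT K.
Proof. by move=> g Kg; apply: sub_generated; left. Qed.

Lemma frakT_section_closed (K : set T2aut) :
  is_subgroup K -> section_closed K -> section_closed (frakT K).
Proof.
move=> gK secK [|b v] g Tg; first by rewrite section_nil.
rewrite -cat1s section_cat; apply: sub_frakT; apply: (secK v).
exact: frakT_section.
Qed.

Lemma diag_act_fix q (g : T2aut) (t : q.-tuple vertex) :
  diag_act g t = t <-> {in t, forall u, g u = u}.
Proof.
split=> [/(congr1 val)/= gt u ut|gt].
  have /eq_in_map : [seq g i | i <- t] = [seq id i | i <- t] by rewrite map_id.
  exact.
by apply/val_inj => /=; rewrite -[RHS]map_id; apply/eq_in_map.
Qed.

Lemma separating_frakT (K : set T2aut) q : (0 < q)%N ->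
  is_subgroup K -> section_closed K -> separating (@diag_act q) K ->
  separating (@diag_act (q + q)) (frakT K).
Proof.
move=> q0 gK secK sepK F FK.
pose F' := [seq f <- [seq section [:: b] g | g <- F, b <- [:: false; true]]
  | f != 1%g].
have [|t tF'] := sepK F'.
  move=> f; rewrite mem_filter => /andP[/eqP f1 /allpairsP[[g b] /= [gF _ fE]]].
  by split=> //; rewrite fE; apply: frakT_section => //; apply FK.
exists (cat_tuple (map_tuple (cons false) t) (map_tuple (cons true) t)) => g gF.
(* If [g] fixes the concatenated tuple, each first-level section of [g] fixes [t], hence is trivial
   by the choice of [t]; it remains to see that [g] is trivial. *)
move=> /diag_act_fix gt; have [_] := FK g gF; apply.
have gbt b u : u \in t -> g (b :: u) = b :: u.
  move=> ut; apply: gt; rewrite mem_cat; apply/orP.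
  by case: b; [right|left]; apply/mapP; exists u.
have sec1 b : section [:: b] g = 1%g.
  apply/eqP/negPn/negP => gb1; apply: (tF' (section [:: b] g)).
    rewrite mem_filter gb1; apply/allpairsP; exists (g, b) => /=.
    by split=> //; case: b {gb1}.
  by apply/diag_act_fix => u /(gbt b) gu; rewrite /= /section_fun /= gu /= drop0.
apply: T2autP => -[|b v]; first by rewrite aut_root.
(* Trivial sections would still allow [g] to swap the two subtrees. An entry of [t], available since
   [q] is positive, rules this out. *)
have t0 := mem_tnth (Ordinal q0) t.
have gb : g [:: b] = [:: b].
  have := gbt b _ t0; rewrite -cat1s aut_cat => /(congr1 (take 1)).
  by rewrite !take_size_cat// aut_size.
have : g ([:: b] ++ v) = g [:: b] ++ section [:: b] g v by exact: aut_cat.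
by rewrite sec1 gb.
Qed.

Lemma iter_frakT_subgroup p (G : set T2aut) :
  is_subgroup G -> is_subgroup (iter_frakT p G).
Proof.
by case: p => [|p] gG; [exact: gG|exact: generated_subgroup].
Qed.

Lemma sub_iter_frakT p (G : set T2aut) : G `<=` iter_frakT p G.
Proof.
by elim: p => [|p IHp] g Gg; [exact: Gg|apply: sub_frakT; exact: IHp].
Qed.

Lemma iter_frakT_section_closed p (G : set T2aut) :
  is_subgroup G -> section_closed G -> section_closed (iter_frakT p G).
Proof.
move=> gG secG; elim: p => [|p IHp]; first exact: secG.
by apply: frakT_section_closed => //; exact: iter_frakT_subgroup.
Qed.

Lemma separating_iter_frakT (R : realType) p (G : set T2aut) :
  is_subgroup G -> section_closed G -> essentially_free R G ->
  separating (@diag_act (2 ^ p)) (iter_frakT p G).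
Proof.
move=> gG secG freeG; elim: p => [|p IHp].
  by rewrite expn0; exact: separating_boundary freeG.
rewrite expnS mul2n -addnn; apply: separating_frakT => //.
- by rewrite expn_gt0.
- exact: iter_frakT_subgroup.
- exact: iter_frakT_section_closed.
Qed.

Lemma class_C_iter_frakT (R : realType) p (G : set T2aut) :
  is_subgroup G -> section_closed G -> essentially_free R G ->
  class_C R (2 ^ p) (iter_frakT p G).
Proof.
move=> gG secG freeG x Gx; apply: regular_norm_le Gx.
- by move=> u; apply/val_inj; rewrite /= map_id.
- by move=> g h u; apply/val_inj; rewrite /= -map_comp.
- exact: iter_frakT_subgroup.
- exact: separating_iter_frakT freeG.
Qed.

(** * Products of factors 1 - g in the group algebra *)

Section product.
Variable R : realType.
Local Notation C := R[i].

(* The product (1 - g_1) ... (1 - g_m) in the group algebra. *)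
Fixpoint prod_one_sub (gs : seq T2aut) : T2aut -> C :=
  if gs is g :: gs' then
    fun h => prod_one_sub gs' h - prod_one_sub gs' (g^-1 * h)%g
  else fun h => (h == 1%g)%:R.

Lemma prod_one_sub_supp (gs : seq T2aut) :
  exists s : seq T2aut, forall h, prod_one_sub gs h != 0 -> h \in s.
Proof.
elim: gs => [|g gs [s IHs]] /=.
  by exists [:: 1%g] => h; rewrite inE pnatr_eq0; case: (h == 1%g).
exists (s ++ [seq (g * h)%g | h <- s]) => h; rewrite mem_cat.
have [->|/IHs ->//] := eqVneq (prod_one_sub gs h) 0.
rewrite sub0r oppr_eq0 => /IHs gh; apply/orP; right.
by apply/mapP; exists (g^-1 * h)%g; rewrite // mulVKg.
Qed.

(** The support consists of products of elements of [gs]. This is applied to membership in a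
    subgroup and to fixing a vertex. *)
Lemma prod_one_sub_ind (P : T2aut -> Prop) (gs : seq T2aut) :
  P 1%g -> (forall g h, g \in gs -> P h -> P (g * h)%g) ->
  forall h, prod_one_sub gs h != 0 -> P h.
Proof.
move=> P1; elim: gs => [_|g gs IHgs PM] /= h.
  by have [->//|_] := eqVneq h 1%g; rewrite eqxx.
have {}IHgs : forall k, prod_one_sub gs k != 0 -> P k.
  by apply: IHgs => k l kgs; apply: PM; rewrite inE kgs orbT.
have [->|/IHgs//] := eqVneq (prod_one_sub gs h) 0.
rewrite sub0r oppr_eq0 => /IHgs Ph.
by rewrite -[h](mulVKg g); apply: PM; rewrite ?mem_head.
Qed.

Lemma group_algebra_prod_one_sub (H : set T2aut) (gs : seq T2aut) :
  is_subgroup H -> (forall g, g \in gs -> H g) ->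
  group_algebra H (prod_one_sub gs).
Proof.
move=> [H1 HM _] gsH; split.
  have [s sP] := prod_one_sub_supp gs.
  by apply: (sub_finite_set (B := [set` s])) => // h; exact: sP.
by apply: prod_one_sub_ind => // g h /gsH; exact: HM.
Qed.

(** The representation is multiplicative: a left factor 1 - g acts as the identity minus the
    operator of [g]. Both terms are computed over one finite list [s'] containing both supports. *)
Lemma perm_rep_prod_one_sub (X : choiceType) (act : T2aut -> X -> X)
    (g : T2aut) (gs : seq T2aut) (xi : X -> C) (y : X) :
  (forall g h u, act (g * h)%g u = act g (act h u)) ->
  perm_rep act (prod_one_sub (g :: gs)) xi y =
  perm_rep act (prod_one_sub gs) xi y -
  perm_rep act (prod_one_sub gs) xi (act (g^-1)%g y).
Proof.
move=> actM; have [s sP] := prod_one_sub_supp gs.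
pose s' := undup (s ++ [seq (g * h)%g | h <- s]).
have us' : uniq s' by exact: undup_uniq.
have s'P h : prod_one_sub gs h != 0 -> h \in s'.
  by move=> /sP hs; rewrite mem_undup mem_cat hs.
have gs'P h : prod_one_sub gs (g^-1 * h)%g != 0 -> h \in s'.
  move=> /sP hs; rewrite mem_undup mem_cat; apply/orP; right.
  by apply/mapP; exists (g^-1 * h)%g; rewrite // mulVKg.
have -> : perm_rep act (prod_one_sub gs) xi (act (g^-1)%g y) =
    perm_rep act (fun h => prod_one_sub gs (g^-1 * h)%g) xi y.
  rewrite [RHS]/perm_rep (reindex_fsbigT (fun h => (g * h)%g)); last first.
    by exists (fun h => (g^-1 * h)%g) => h; rewrite ?mulKg ?mulVKg.
  by apply: eq_fsbigr => h _; rewrite mulKg invgM actM.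
rewrite !(perm_rep_seq _ _ _ us') //; last first.
  move=> h /=; have [->|/s'P//] := eqVneq (prod_one_sub gs h) 0.
  by rewrite sub0r oppr_eq0 => /gs'P.
by rewrite -sumrB; apply: eq_bigr => h _; rewrite mulrBl.
Qed.

(** Induction on [gs]. If [g] is the head, the two terms agree because [g] fixes [y]. Otherwise [g]
    commutes with the head [k], so it also fixes the translate of [y] by the inverse of [k], and
    both terms vanish by induction. *)
Lemma perm_rep_prod_one_sub_eq0 (X : choiceType) (act : T2aut -> X -> X)
    (gs : seq T2aut) (g : T2aut) (xi : X -> C) (y : X) :
  (forall u, act 1%g u = u) ->
  (forall g h u, act (g * h)%g u = act g (act h u)) ->
  {in gs &, forall g h, g * h = h * g}%g -> g \in gs -> act g y = y ->
  perm_rep act (prod_one_sub gs) xi y = 0.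
Proof.
move=> act1 actM; elim: gs y => // k gs IHgs y comm.
have {}IHgs z : g \in gs -> act g z = z ->
    perm_rep act (prod_one_sub gs) xi z = 0.
  by apply: IHgs => a b ags bgs; apply: comm; rewrite inE ?ags ?bgs orbT.
rewrite perm_rep_prod_one_sub// inE => /predU1P[<-|ggs] gy.
  have {1}-> : y = act (g^-1)%g y by rewrite -[in RHS]gy -actM mulVg act1.
  by rewrite subrr.
have gk : (g * k^-1 = k^-1 * g)%g.
  apply: (mulgI k); rewrite mulVKg mulgA.
  by rewrite (comm k g) ?mulgK// inE ?eqxx ?ggs ?orbT.
by rewrite !IHgs ?subrr// -actM gk actM gy.
Qed.

Lemma prod_one_sub_nil1 : prod_one_sub [::] 1%g = 1.
Proof. by rewrite /= eqxx. Qed.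

(** The new contribution at 1 is the old coefficient at the inverse of [g]. It vanishes because the
    old support fixes [v] and [g] does not. Iterating this shows that the product is nonzero. *)
Lemma prod_one_sub_cons1 (g : T2aut) (gs : seq T2aut) (v : vertex) :
  g v <> v -> (forall h, h \in gs -> h v = v) -> prod_one_sub gs 1%g = 1 ->
  prod_one_sub (g :: gs) 1%g = 1.
Proof.
move=> gv gsv /= ->; rewrite mulg1.
rewrite (_ : prod_one_sub gs (g^-1)%g = 0) ?subr0//.
apply/eqP/negPn/negP => /(prod_one_sub_ind (P := fun h => h v = v)) gVv.
apply: gv; rewrite -{1}gVv ?aut_invK//= => h k /gsv hv kv.
by rewrite /= kv.
Qed.

(** Applying [x] to the unit vector at 1 gives a function whose value at 1 is [x 1]. *)
Lemma regular_norm_ge1 (H : set T2aut) (x : T2aut -> C) :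
  H 1%g -> x 1%g = 1 -> (1 <= regular_norm H x)%E.
Proof.
move=> H1 x1; pose delta (h : T2aut) : C := if h == 1%g then 1 else 0.
have sqrte1 : sqrte (1 : \bar R) = 1%E by rewrite /= sqrtr1.
have sqmod1 : (complex.Re (1 : C) ^+ 2 + complex.Im (1 : C) ^+ 2)%:E = 1%E.
  by rewrite /= expr1n expr0n addr0.
have norm_delta : (l2_norm H delta <= 1)%E.
  rewrite -sqrte1 lee_sqrt ?lee01//.
  apply: (@le_trans _ _ (\esum_(h in [set 1%g : T2aut])
      (complex.Re (delta h) ^+ 2 + complex.Im (delta h) ^+ 2)%:E)%E).
    rewrite [leRHS]esum_mkcond.
    apply: (le_trans (esum_le_subset _ (@subsetT _ H))).
    apply: le_esum => h _; case: ifPn => //; rewrite notin_setE => /eqP/negPf h1.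
    by rewrite /delta h1 sqmod0.
  by rewrite esum_set1 ?sqmod_ge0// /delta eqxx sqmod1.
pose eta := perm_rep (fun g h => (g * h)%g) x delta.
have eta1 : eta 1%g = 1.
  rewrite /eta /perm_rep -(fsbig_widen [set 1%g]) ?fsbig_set1//.
    by rewrite x1 /delta invg1 mulg1 eqxx mulr1.
  move=> h [_ /eqP/negPf h1]; rewrite /= mulg1 /delta.
  by rewrite -(inj_eq invg_inj) invgK invg1 h1 mulr0.
apply: (@le_trans _ _ (l2_norm H eta)).
  rewrite -sqrte1 lee_sqrt; last by apply: esum_ge0 => h _; exact: sqmod_ge0.
  apply: (@le_trans _ _ (\esum_(h in [set 1%g : T2aut])
      (complex.Re (eta h) ^+ 2 + complex.Im (eta h) ^+ 2)%:E)%E).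
    by rewrite esum_set1 ?sqmod_ge0// eta1 sqmod1.
  by apply: esum_le_subset => _ ->.
by apply: ereal_sup_ubound; exists delta.
Qed.
End product.

Lemma class_C_annihilator (R : realType) q (H : set T2aut) (x : T2aut -> R[i]) :
  H 1%g -> group_algebra H x -> x 1%g = 1 ->
  (forall xi t, perm_rep (@diag_act q) x xi t = 0) -> ~ class_C R q H.
Proof.
move=> H1 Hx x1 x0 CH.
have := le_trans (regular_norm_ge1 H1 x1) (CH x Hx); apply/negP; rewrite -ltNge.
apply: (@le_lt_trans _ _ 0%E); last exact: lte01.
by apply: ge_ereal_sup => _ [xi _ <-]; rewrite l2_norm0.
Qed.

(** * Elements supported below a vertex, and failure of the smaller class *)

Definition supported_below (v : vertex) (g : T2aut) :=
  forall u, ~~ prefix v u -> g u = u.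

Lemma supported_below_prefix v g u :
  supported_below v g -> prefix v u -> prefix v (g u).
Proof.
move=> vg vu; apply/negPn/negP => /[dup] /negP gu /vg /(can_inj (aut_funK g)) e.
by rewrite e vu in gu.
Qed.

Lemma prefix_eq_size (v w u : vertex) :
  size v = size w -> prefix v u -> prefix w u -> v = w.
Proof. by move=> svw; rewrite !prefixE svw => /eqP <- /eqP. Qed.

(** At equal level the subtrees below [v] and [w] are disjoint, and an element supported below a
    vertex preserves the subtree there. *)
Lemma supported_below_comm v w g h :
  size v = size w -> v <> w -> supported_below v g -> supported_below w h ->
  (g * h = h * g)%g.
Proof.
move=> svw vw vg wh; apply: T2autP => u /=.
have [vu|vu] := boolP (prefix v u).
  have nw z : prefix v z -> ~~ prefix w z.
    by move=> vz; apply/negP => /(prefix_eq_size svw vz).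
  by rewrite (wh u) ?(wh (g u))// ?nw//; exact: supported_below_prefix.
rewrite (vg u)//; have [wu|wu] := boolP (prefix w u); last by rewrite wh// vg.
apply: vg; apply/negP => /(prefix_eq_size svw) e.
by apply: vw; apply: e; exact: supported_below_prefix.
Qed.

Lemma supported_below_conj v (g h : T2aut) :
  supported_below v g -> supported_below (h v) (h * g * h^-1)%g.
Proof.
move=> vg u hvu; have /vg /= -> : ~~ prefix v (aut_inv h u).
  apply: contra hvu => /prefixP[s e].
  by rewrite -(aut_invK h u) e aut_cat prefix_prefix.
exact: aut_invK.
Qed.

Lemma supported_below_pair1 v g :
  supported_below v g -> supported_below (true :: v) (pair1 g).
Proof. by move=> vg [|[] u] //= vu; rewrite vg. Qed.

(** Nesting [pair1] gives an element supported below the vertex with all letters 2; an element of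
    [G] carrying that vertex to [v] conjugates it to one supported below [v]. *)
Lemma iter_frakT_supported p (G : set T2aut) (v : vertex) :
  is_subgroup G -> spherically_transitive G -> size v = p ->
  exists g, [/\ iter_frakT p G g, g <> 1%g & supported_below v g].
Proof.
move=> gG transG vp.
have [g [Tg g1 sg]] : exists g,
    [/\ iter_frakT p G g, g <> 1%g & supported_below (nseq p true) g].
  elim: {v vp} p => [|p [g [Tg g1 sg]]].
    (* Transitivity on level one forces [G] to be nontrivial. *)
    have [g Gg gE] := transG 1%N [:: false] [:: true] erefl erefl.
    exists g; split=> //; first by move=> e; move: gE; rewrite e.
    by move=> u; rewrite prefix0s.
  exists (pair1 g); split; last exact: supported_below_pair1.
    by apply: sub_generated; right; exists g.
  move=> e; apply: g1; apply: T2autP => v.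
  by have := congr1 (fun h : T2aut => h (true :: v)) e; case.
have [h /(sub_iter_frakT p) Th hv] := transG p _ _ (size_nseq p true) vp.
have [_ TM TV] := iter_frakT_subgroup p gG.
exists (h * g * h^-1)%g; split; last by rewrite -hv; exact: supported_below_conj.
  by apply: (TM); [exact: TM|exact: TV].
move=> /(congr1 (fun k => h^-1 * k * h)%g).
by rewrite mulg1 mulVg -!mulgA mulKg mulVg mulg1.
Qed.

(** Pigeonhole: otherwise all [2 ^ p] words of length [p] would occur among the truncations of the
    [q] entries. *)
Lemma exists_not_prefix p q (t : q.-tuple vertex) : (q < 2 ^ p)%N ->
  exists v : p.-tuple bool, forall u, u \in t -> ~~ prefix v u.
Proof.
move=> qp; apply: contrapT => /forallNP pt.
have : (2 ^ p <= q)%N.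
  rewrite -(size_tuple t) -(size_map (take p)).
  rewrite -[X in (X ^ _)%N]card_bool -card_tuple cardE -(size_map val).
  apply: uniq_leq_size.
    by rewrite (map_inj_uniq val_inj) enum_uniq.
  move=> _ /mapP[v _ ->]; have /existsNP[u] := pt v.
  move=> /not_implyP[ut /negP/negPn]; rewrite prefixE size_tuple => /eqP uv.
  by rewrite /= -uv; exact: map_f.
by rewrite leqNgt qp.
Qed.

Lemma not_class_C_iter_frakT (R : realType) p q (G : set T2aut) :
  is_subgroup G -> spherically_transitive G -> (q < 2 ^ p)%N ->
  ~ class_C R q (iter_frakT p G).
Proof.
move=> gG transG qp.
have /choice[f fP] : forall v : p.-tuple bool, exists g,
    [/\ iter_frakT p G g, g <> 1%g & supported_below v g].
  by move=> v; apply: iter_frakT_supported; rewrite // size_tuple.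
have disj (v w : p.-tuple bool) u : prefix v u -> prefix w u -> v = w.
  by move=> vu wu; apply/val_inj/(prefix_eq_size _ vu wu); rewrite !size_tuple.
pose gs := [seq f v | v <- enum {: p.-tuple bool}].
have gT := iter_frakT_subgroup p gG; have [T1 _ _] := gT.
apply: (class_C_annihilator (x := prod_one_sub R gs)) => //.
- apply: group_algebra_prod_one_sub => // _ /mapP[v _ ->].
  by have [] := fP v.
(* A vertex [u] moved by [f v] lies below [v], hence is fixed by the elements attached to the other
   vertices of level [p]. *)
- rewrite /gs; elim: (enum _) (enum_uniq {: p.-tuple bool}) => [_|v s IHs].
    exact: prod_one_sub_nil1.
  move=> /= /andP[vs /IHs s1].
  have [_ fv1 fv] := fP v.
  have [u fu] : exists u, f v u <> u.
    apply: contrapT => /forallNP fu; apply: fv1; apply: T2autP => u.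
    by apply: contrapT; exact: fu.
  have vu : prefix v u by apply/negPn/negP => /fv.
  apply: (prod_one_sub_cons1 fu) => // _ /mapP[w ws ->].
  have [_ _] := fP w; apply; apply: contra vs => /(disj _ _ _ vu) e.
  by rewrite e.
move=> xi t; have [v vt] := exists_not_prefix t qp.
apply: (perm_rep_prod_one_sub_eq0 (g := f v)).
- by move=> u; apply/val_inj; rewrite /= map_id.
- by move=> g h u; apply/val_inj; rewrite /= -map_comp.
- move=> _ _ /mapP[v1 _ ->] /mapP[v2 _ ->].
  have [->//|/eqP v12] := eqVneq v1 v2.
  have [_ _ s1] := fP v1; have [_ _ s2] := fP v2.
  by apply: supported_below_comm s1 s2; rewrite ?size_tuple// => /val_inj.
- by apply: map_f; rewrite mem_enum.
- by apply/diag_act_fix => u /vt; have [_ _] := fP v; apply.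
Qed.

Theorem proposition4p8 (R : realType) (G : set T2aut)
    (subgroupG : is_subgroup G)
    (fgG : finitely_generated G)
    (self_similarG : self_similar G)
    (essentially_freeG : essentially_free R G)
    (transitiveG : spherically_transitive G)
    (p : nat) (p_gt0 : (0 < p)%N) :
  class_C R (2 ^ p)%N (iter_frakT p G) /\
  ~ class_C R (2 ^ p - 1)%N (iter_frakT p G).
Proof.
split.
  exact: class_C_iter_frakT (self_similar_section self_similarG) _.
by apply: not_class_C_iter_frakT; rewrite // subn1 ltn_predL expn_gt0.
Qed.
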